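(* Let $d>2$ be an integer and let $\Omega\subseteq\mathbb{R}^d\times\mathbb{R}^d$ be a measurable set with $\mathcal{L}^{2d}(\Omega)>0$. Then for every $p\in(p_*(d),\infty]$ \[ \sup_{f\in L^2(\mathbb{R}^d)\setminus\{0\}}\frac{\|W_{\mathrm{BJ}}f\|_{L^p(\Omega)}}{\|f\|_{L^2(\mathbb{R}^d)}^2}=\infty. \]
   Context: Functions in $L^2(\mathbb{R}^d)$ are complex-valued, and $\mathcal{L}^{2d}$ is Lebesgue measure on $\mathbb{R}^{2d}$. For $f\in L^2(\mathbb{R}^d)$, $\tau\in(0,1)$ and $z=(x,\xi)\in\mathbb{R}^d\times\mathbb{R}^d$, the $\tau$-Wigner distribution is \[ W_\tau f(z)=\int_{\mathbb{R}^d}e^{-2\pi i\xi\cdot y}f(x+\tau y)\,\overline{f(x-(1-\tau)y)}\,dy, \] and the Born--Jordan distribution is $W_{\mathrm{BJ}}f(z)=\int_0^1 W_\tau f(z)\,d\tau$ (the integral in $\tau$ converges absolutely for a.e. $z$ and $W_{\mathrm{BJ}}f\in L^2(\mathbb{R}^{2d})$). The critical exponent for $d\ge 3$ is $p_*(d)=\left(\frac12-\frac1d\right)^{-1}=\frac{2d}{d-2}$. The norm $\|W_{\mathrm{BJ}}f\|_{L^p(\Omega)}$ is understood to be $\infty$ if $W_{\mathrm{BJ}}f\notin L^p(\Omega)$. *)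

(* Defs.v *)
From HB Require Import structures.
From mathcomp Require Import all_boot all_order all_algebra.
From mathcomp Require Import all_classical all_reals all_analysis.
From mathcomp.real_closed Require Export complex.
Set Implicit Arguments.
Unset Strict Implicit.
Unset Printing Implicit Defensive.
Import Order.TTheory GRing.Theory Num.Theory.
Import numFieldNormedType.Exports.
Local Open Scope classical_set_scope.
Local Open Scope ring_scope.

Section cons_measure.
Context (R : realType) (n : nat).
Variable mu : {sigma_finite_measure set (n.-tuple R) -> \bar R}.

Definition cons_pair (xt : R * n.-tuple R) : n.+1.-tuple R :=
  [the n.+1.-tuple _ of xt.1 :: xt.2].

Lemma measurable_cons_pair : measurable_fun [set: _] cons_pair.
Proof. exact: measurable_cons. Qed.

Definition cons_measure : set (n.+1.-tuple R) -> \bar R :=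
  pushforward (lebesgue_measure \x mu)%E cons_pair.

Let cons_measure0 : cons_measure set0 = 0%E.
Proof. by rewrite /cons_measure /pushforward preimage_set0 measure0. Qed.

Let cons_measure_ge0 A : (0 <= cons_measure A)%E.
Proof. exact: integral_ge0. Qed.

Let cons_measure_sigma_additive : semi_sigma_additive cons_measure.
Proof.
move=> F mF tF mUF; rewrite /cons_measure /pushforward preimage_bigcup.
apply: measure_semi_sigma_additive.
- by move=> k; rewrite -[X in measurable X]setTI; exact: measurable_cons_pair.
- apply/trivIsetP => /= i j _ _ ij; rewrite -preimage_setI.
  by move/trivIsetP : tF => /(_ _ _ _ _ ij) ->//; rewrite preimage_set0.
- rewrite -preimage_bigcup -[X in measurable X]setTI.
  exact: measurable_cons_pair.
Qed.

HB.instance Definition _ := isMeasure.Build _ _ _ cons_measure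
  cons_measure0 cons_measure_ge0 cons_measure_sigma_additive.

Let cons_measure_sigma_finite : sigma_finite [set: _] cons_measure.
Proof.
have /sigma_finiteP[F [TF ndF Foo]] :=
  sigma_finiteT (@lebesgue_measure R : {sigma_finite_measure set _ -> \bar R}).
have /sigma_finiteP[G [TG ndG Goo]] := sigma_finiteT mu.
pose uncons (t : n.+1.-tuple R) : R * n.-tuple R :=
  (tnth t ord0, [tuple of behead t]).
have muncons : measurable_fun [set: _] uncons.
  apply: measurable_fun_pair; first exact: measurable_tnth.
  exact: measurable_behead.
exists (fun k => uncons @^-1` (F k `*` G k)).
  rewrite -preimage_bigcup (_ : \bigcup_k (F k `*` G k) = setT) ?preimage_setT//.
  rewrite -subTset => -[x t] _.
  have [i _ Fix] : (\bigcup_k F k) x by rewrite -TF.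
  have [j _ Gjt] : (\bigcup_k G k) t by rewrite -TG.
  exists (maxn i j) => //; split => /=.
    by move: x Fix; exact/subsetPset/ndF/leq_maxl.
  by move: t Gjt; exact/subsetPset/ndG/leq_maxr.
move=> k; have [? ?] := Foo k; have [? ?] := Goo k.
have mFG : measurable (F k `*` G k) by exact: measurableX.
split; first by rewrite -[X in measurable X]setTI; exact: muncons.
rewrite /cons_measure /pushforward -comp_preimage.
have -> : uncons \o cons_pair = idfun.
  by apply/funext => -[x t]; congr pair; exact/val_inj.
by rewrite preimage_id product_measure1E// lte_mul_pinfty// ge0_fin_numE.
Qed.

HB.instance Definition _ := Measure_isSigmaFinite.Build _ _ _ cons_measure
  cons_measure_sigma_finite.

End cons_measure.

(* Lebesgue measure on the Borel (product) sigma-algebra of R^n, with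
   R^0 a one-point space of mass 1 and R^(n+1) = R x R^n. *)
Fixpoint lebesgue_tuple (R : realType) (n : nat) :
    {sigma_finite_measure set (n.-tuple R) -> \bar R} :=
  match n with
  | 0 => \d_([tuple] : 0.-tuple R)
  | m.+1 => cons_measure (lebesgue_tuple R m)
  end.

(* T with the sigma-algebra completed with respect to the measure [mu] on T.
   The type itself is convertible to T. *)
Notation completion_type mu := (caratheodory_type (mu^*)%mu).

(* Lebesgue measure on R^d and on R^d x R^d, defined on all
   Lebesgue-measurable sets. *)
Definition lebesgue_Rd (R : realType) (d : nat) :
    {measure set (completion_type (lebesgue_tuple R d)) -> \bar R} :=
  @completed_measure_extension _ _ R (lebesgue_tuple R d).

Notation phase_space R d :=
  (completion_type (lebesgue_tuple R d \x lebesgue_tuple R d)%E).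

Definition lebesgue_R2d (R : realType) (d : nat) :
    {measure set (phase_space R d) -> \bar R} :=
  @completed_measure_extension _ _ R
    (lebesgue_tuple R d \x lebesgue_tuple R d)%E.

Section complex_valued.
Context d (T : measurableType d) (R : realType).
Variable mu : {measure set T -> \bar R}.
Local Open Scope complex_scope.

Definition cmeasurable (f : T -> R[i]) : Prop :=
  measurable_fun [set: T] (fun x => complex.Re (f x)) /\
  measurable_fun [set: T] (fun x => complex.Im (f x)).

Definition cintegral (D : set T) (f : T -> R[i]) : R[i] :=
  (\int[mu]_(x in D) complex.Re (f x)) +i* (\int[mu]_(x in D) complex.Im (f x)).

Definition cLnorm (p : \bar R) (f : T -> R[i]) : \bar R :=
  Lnorm mu p (fun x => (ComplexField.Normc.normc (f x))%:E).

Definition L2fun (f : T -> R[i]) : Prop :=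
  cmeasurable f /\ (cLnorm 2%:E f < +oo)%E.

End complex_valued.

Section Wigner.
Context (R : realType) (d : nat).
Local Open Scope complex_scope.
Implicit Types (x xi y : d.-tuple R) (f : d.-tuple R -> R[i]).

(* x + c y *)
Definition add_scaled x (c : R) y : d.-tuple R :=
  [tuple tnth x i + c * tnth y i | i < d].

Definition dotp xi y : R := \sum_(i < d) tnth xi i * tnth y i.

(* exp(- 2 pi i t) *)
Definition expm2pi (t : R) : R[i] := cos (2 * pi * t) -i* sin (2 * pi * t).

Definition tau_wigner (tau : R) f (z : d.-tuple R * d.-tuple R) : R[i] :=
  cintegral (lebesgue_Rd R d) setT (fun y =>
    expm2pi (dotp z.2 y) * f (add_scaled z.1 tau y)
      * conjc (f (add_scaled z.1 (- (1 - tau)) y))).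

Definition born_jordan f (z : d.-tuple R * d.-tuple R) : R[i] :=
  cintegral lebesgue_measure `]0, 1[ (fun tau => tau_wigner tau f z).

Definition critical_exponent : R := (2^-1 - d%:R^-1)^-1.

End Wigner.

(* Main.v *)
Require Import Defs.
From mathcomp Require Import all_boot all_order all_algebra.
From mathcomp Require Import all_classical all_reals all_analysis.
From mathcomp Require Import measurable_realfun ring lra.
Import Order.TTheory GRing.Theory Num.Theory.
Import numFieldNormedType.Exports.
Local Open Scope classical_set_scope.
Local Open Scope ring_scope.
Local Open Scope complex_scope.

(** The Born--Jordan distribution of f blows up where the small-tau part of the
    integral over tau pairs a concentrated piece of f with a spread-out one.
    Take eps > 0 and H = eps ^ (- d / 2), and let r be H on the cube of radius
    2 eps about x0 plus 1 on the cube of radius 1 about x0, a function whose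
    L^2 norm is bounded independently of eps.  For x within eps of x0, tau
    below eps and y in the cube of radius 1/2, the point x + tau y lies in the
    small cube and x - (1 - tau) y in the large one, so the integrand of W_tau r
    is at least H there; integrating over tau < eps gives
    W_BJ r >= c H eps = c eps ^ (1 - d / 2).

    Modulating r by exp (2 pi i xi0 . x) translates W_BJ by xi0 in the frequency
    variable.  When xi stays within 1 / (16 d) of xi0 the remaining phase
    2 pi (xi - xi0) . y is at most 1 in absolute value on the support of the
    integrand, so that the real part of the integrand is nonnegative and no
    cancellation occurs (Re_wigner_integrand, cos_phase_ge, Re_born_jordan).
    Only the monotonicity of the integral of nonnegative functions is then
    needed, and the lower bound holds at every point of the cell
    (cube of radius eps about x0) x (cube of radius 1 / (16 d) about xi0).

    It remains to place this cell so that it meets Omega in a set of measure at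
    least c eps ^ d.  Some bounded part of Omega has positive measure, and it is
    covered by O (eps ^ (- d)) such cells, one of which therefore carries at
    least the average (exists_heavy_cell).  For that cell
    the L^p norm of W_BJ f over Omega is at least
    c eps ^ (1 - d / 2) (c eps ^ d) ^ (1 / p), and the exponent
    1 - d / 2 + d / p of eps is negative exactly when p > 2 d / (d - 2).
    The proof uses eps = 1 / k ^ 2 with k an integer, so that H = k ^ d. *)

(** * Estimates for integrals and Lebesgue norms *)

(** The integral of a nonnegative function is the supremum of the integrals of
    the simple functions below it, which makes it monotone even on
    non-measurable functions.  Marginals such as tau |-> W_tau f z can thus be
    estimated without proving them measurable. *)
Lemma ge0_le_integral_nomeas {d} {T : measurableType d} {R : realType}
    (mu : {measure set T -> \bar R}) (D : set T) (f g : T -> \bar R) :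
  (forall x, D x -> (0 <= f x)%E) -> (forall x, D x -> (f x <= g x)%E) ->
  (\int[mu]_(x in D) f x <= \int[mu]_(x in D) g x)%E.
Proof.
move=> f0 fg.
have g0 x : D x -> (0 <= g x)%E by move=> Dx; rewrite (le_trans (f0 x Dx))// fg.
rewrite !ge0_integralE //= ge_ereal_sup// => _ [h/= hf] <-.
apply: ereal_sup_ubound; exists h => //= x; apply: (le_trans (hf x)).
by rewrite /patch; case: ifPn => // /set_mem; exact: fg.
Qed.

Lemma integral_cst_indic {d} {T : measurableType d} {R : realType}
    (mu : {measure set T -> \bar R}) (D A : set T) (c : R) :
  measurable D -> measurable A -> A `<=` D -> 0 <= c ->
  (\int[mu]_(x in D) (c * \1_A x)%:E = c%:E * mu A)%E.
Proof.
move=> mD mA AD c0; under eq_integral do rewrite EFinM.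
rewrite ge0_integralZl//.
- by rewrite integral_indic//; congr (_ * mu _)%E; exact/setIidPl.
- by apply/measurable_EFinP; exact: measurable_indic.
Qed.

Lemma integral_two_indic {d} {T : measurableType d} {R : realType}
    (mu : {measure set T -> \bar R}) (A B : set T) (a b : R) :
  measurable A -> measurable B -> 0 <= a -> 0 <= b ->
  (\int[mu]_x (a * \1_A x + b * \1_B x)%:E = a%:E * mu A + b%:E * mu B)%E.
Proof.
move=> mA mB a0 b0; under eq_integral do rewrite EFinD.
have mI (c : R) (C : set T) : measurable C ->
    measurable_fun setT (fun x => (c * \1_C x)%:E).
  by move=> mC; apply/measurable_EFinP/measurable_funM => //; exact: measurable_indic.
have I0 (c : R) (C : set T) : 0 <= c -> forall x, setT x -> (0 <= (c * \1_C x)%:E)%E.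
  by move=> c0 x _; rewrite lee_fin mulr_ge0.
by rewrite ge0_integralD ?integral_cst_indic//; [exact: I0|exact: mI|exact: I0|exact: mI].
Qed.

(** The real-valued integral sends an infinite integral to 0, so that a lower
    bound is meaningful only together with an upper bound; the two are therefore
    established at once. *)
Lemma Rintegral_between {d} {T : measurableType d} {R : realType}
    (mu : {measure set T -> \bar R}) (D A B : set T) (a b : R) (f : T -> R) :
  measurable D -> measurable A -> measurable B -> A `<=` D -> B `<=` D ->
  0 <= a -> 0 <= b -> (mu A < +oo)%E -> (mu B < +oo)%E ->
  (forall x, D x -> a * \1_A x <= f x <= b * \1_B x) ->
  a * fine (mu A) <= \int[mu]_(x in D) f x <= b * fine (mu B).
Proof.
move=> mD mA mB AD BD a0 b0 Aoo Boo fab.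
have f0 x : D x -> 0 <= f x.
  by move=> /fab/andP[+ _]; apply: le_trans; rewrite mulr_ge0.
have If0 : (0 <= \int[mu]_(x in D) (f x)%:E)%E.
  by apply: integral_ge0 => x Dx; rewrite lee_fin f0.
have lf : (a%:E * mu A <= \int[mu]_(x in D) (f x)%:E)%E.
  rewrite -(integral_cst_indic mu D)//; apply: ge0_le_integral_nomeas => x Dx.
    by rewrite lee_fin mulr_ge0.
  by rewrite lee_fin; have /andP[] := fab x Dx.
have rf : (\int[mu]_(x in D) (f x)%:E <= b%:E * mu B)%E.
  rewrite -(integral_cst_indic mu D)//; apply: ge0_le_integral_nomeas => x Dx.
    by rewrite lee_fin f0.
  by rewrite lee_fin; have /andP[] := fab x Dx.
have finA : mu A \is a fin_num by rewrite ge0_fin_numE.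
have finB : mu B \is a fin_num by rewrite ge0_fin_numE.
have finI : (\int[mu]_(x in D) (f x)%:E \is a fin_num)%E.
  rewrite ge0_fin_numE//; apply: (le_lt_trans rf).
  by rewrite -(fineK finB) -EFinM ltry.
rewrite /Rintegral -!lee_fin (fineK finI) !EFinM !fineK//.
by rewrite lf.
Qed.

(** Chebyshev's inequality.  With p^-1 = 0 for p = +oo, the bound
    m ^ (1 / p) covers the essential supremum as well. *)
Lemma Lnorm_ge {d} {T : measurableType d} {R : realType}
    (mu : {measure set T -> \bar R}) (E : set T) (F : T -> \bar R) (p : \bar R)
    (a m : R) :
  measurable E -> (0 < p)%E -> 0 <= a -> 0 < m -> (m%:E <= mu E)%E ->
  (forall x, E x -> (a%:E <= `|F x|)%E) ->
  ((a * m `^ fine p^-1)%:E <= Lnorm mu p F)%E.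
Proof.
move=> mE p0 a0 m0 mmu aF; rewrite unlock; case: p p0 => [p|_|//].
- rewrite lte_fin => p0; rewrite inver gt_eqF//=.
  have pV : 0 <= p^-1 by rewrite invr_ge0 ltW.
  have : ((a `^ p * m)%:E <= \int[mu]_x (`|F x| `^ p))%E.
    apply: (@le_trans _ _ ((a `^ p)%:E * mu E)%E).
      by rewrite EFinM lee_wpmul2l// lee_fin powR_ge0.
    rewrite -(integral_cst_indic mu setT)//; last exact: powR_ge0.
    apply: ge0_le_integral_nomeas => x _; first by rewrite lee_fin mulr_ge0 ?powR_ge0.
    have [xE|xE] := boolP (x \in E); rewrite indicE ?xE ?(negbTE xE) ?mulr1 ?mulr0.
      rewrite -poweR_EFin; apply: gt0_ler_poweR; rewrite ?(ltW p0)// ?in_itv/= ?leey ?andbT.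
      - by rewrite lee_fin.
      - exact: abse_ge0.
      - exact: aF (set_mem xE).
    exact: poweR_ge0.
  have -> : a * m `^ p^-1 = (a `^ p * m) `^ p^-1.
    by rewrite powRM ?powR_ge0// -?powRrM ?mulfV ?gt_eqF ?powRr1// ltW.
  rewrite -poweR_EFin; apply: gt0_ler_poweR => //; rewrite in_itv/= leey andbT.
    by rewrite lee_fin mulr_ge0 ?powR_ge0 ?ltW.
  by apply: integral_ge0 => x _; exact: poweR_ge0.
- rewrite invey/= powRr0 mulr1 ifT; last first.
    by rewrite (lt_le_trans _ (le_measure mu _ _ (@subsetT _ E))) ?inE// (lt_le_trans _ mmu) ?lte_fin.
  rewrite leNgt; apply/negP => lt_a.
  have E0 : mu E = 0%E.
    apply: (negligibleP mu mE).1.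
    apply: negligibleS (ess_sup_inf.ess_sup_ge mu (abse \o F)) => x /= Ex.
    by apply/negP; rewrite -ltNge; exact: lt_le_trans (aF x Ex).
  by move: mmu; rewrite E0 lee_fin leNgt m0.
Qed.

(** * Cubes and their Lebesgue measure *)

Definition box {R : realType} {n : nat} (x : n.-tuple R) (r : R) :
  set (n.-tuple R) := [set y | forall i, `|tnth y i - tnth x i| <= r].

Lemma measurable_box {R : realType} {n : nat} (x : n.-tuple R) (r : R) :
  measurable (box x r).
Proof.
have -> : box x r = \bigcap_(i in [set: 'I_n])
    ((fun y : n.-tuple R => tnth y i) @^-1` `[tnth x i - r, tnth x i + r]).
  apply/seteqP; split=> y /= xy i => [_|]; last first.
    by move: (xy i Logic.I); rewrite /= in_itv/= ler_distl.
  by rewrite /= in_itv/= -ler_distl; exact: xy.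
apply: fin_bigcap_measurable => // i _; rewrite -[X in measurable X]setTI.
exact: measurable_tnth.
Qed.

Lemma lebesgue_tuple_box {R : realType} {n : nat} (x : n.-tuple R) (r : R) :
  0 <= r -> lebesgue_tuple R n (box x r) = ((2 * r) ^+ n)%:E.
Proof.
move=> r0; elim: n x => [|n IH] x.
  by rewrite /= diracE expr0 mem_set// => -[].
case/tupleP: x => a x.
rewrite [LHS]/= /cons_measure /pushforward.
have -> : cons_pair (n := n) @^-1` (box [tuple of a :: x] r) =
          `[a - r, a + r]%classic `*` box x r.
  apply/seteqP; split => -[b y] /=.
    move=> h; split; first by rewrite in_itv/= -ler_distl; have := h ord0; rewrite !tnth0.
    by move=> i; have := h (lift ord0 i); rewrite !tnthS.
  rewrite in_itv/= -ler_distl => -[h0 h] i.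
  by case: (unliftP ord0 i) => [j|] ->; rewrite ?tnth0 ?tnthS//.
rewrite product_measure1E//; last exact: measurable_box.
rewrite exprS EFinM; congr (_ * _)%E; last exact: IH.
rewrite [LHS](lebesgue_measure_itv `[a - r, a + r])/= lte_fin.
have [rr|rr] := ltP (a - r) (a + r); first by rewrite -EFinB; congr _%:E; lra.
have -> : r = 0 by lra.
by rewrite mulr0.
Qed.

Lemma borel_lebesgue {R : realType} {n : nat} (A : set (n.-tuple R)) :
  measurable A -> measurable (A : set (completion_type (lebesgue_tuple R n))).
Proof. exact: caratheodory_measurable_mu_ext. Qed.

Lemma borel_lebesgue2 {R : realType} {n : nat}
    (A B : set (n.-tuple R)) :
  measurable A -> measurable B -> measurable (A `*` B : set (phase_space R n)).
Proof.
by move=> mA mB; apply: caratheodory_measurable_mu_ext; exact: measurableX.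
Qed.

Lemma lebesgue_Rd_box {R : realType} {n : nat} (x : n.-tuple R) (r : R) :
  0 <= r -> lebesgue_Rd R n (box x r) = ((2 * r) ^+ n)%:E.
Proof.
move=> r0; rewrite -(lebesgue_tuple_box x)//.
exact: (measurable_mu_extE (lebesgue_tuple R n) (measurable_box x r)).
Qed.

Lemma measurable_lebesgue {R : realType} {n : nat} (f : n.-tuple R -> R) :
  measurable_fun [set: n.-tuple R] f ->
  measurable_fun [set: completion_type (lebesgue_tuple R n)] f.
Proof.
move=> mf _ Y mY; have := mf measurableT _ mY; rewrite !setTI.
exact: borel_lebesgue.
Qed.

(** * A cell carrying its share of a set of positive measure *)

Local Notation origin R n := [tuple (0 : R) | _ < n].

Lemma grid1_cover {R : realType} (M N : nat) (x : R) : (0 < N)%N ->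
  `|x| <= M%:R ->
  exists j : 'I_((2 * M + 1) * N), `|x - (j%:R / N%:R - M%:R)| <= N%:R^-1.
Proof.
move=> N0; rewrite ler_norml => /andP[lx xM].
have NR : 0 < N%:R :> R by rewrite ltr0n.
pose t := (x + M%:R) * N%:R.
have t0 : 0 <= t by rewrite mulr_ge0 ?(ltW NR)//; lra.
have /andP[jt tj] := truncn_itv t0.
have jlt : (Num.truncn t < (2 * M + 1) * N)%N.
  rewrite -(ltr_nat R); apply: (le_lt_trans jt).
  rewrite natrM ltr_pM2r// natrD natrM; lra.
exists (Ordinal jlt) => /=.
have -> : x - ((Num.truncn t)%:R / N%:R - M%:R) = (t - (Num.truncn t)%:R) / N%:R.
  by rewrite /t; field; rewrite gt_eqF.
rewrite normrM (@ger0_norm _ N%:R^-1) ?invr_ge0 ?(ltW NR)// ler_piMl ?invr_ge0 ?(ltW NR)//.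
by rewrite ger0_norm; move: tj; rewrite -natr1; lra.
Qed.

(** The indices run past 2 M N, so that the cubes of radius 1 / N about these
    points cover the closed cube of radius M, its far faces included. *)
Definition grid {R : realType} {n : nat} (M N : nat)
    (j : n.-tuple 'I_((2 * M + 1) * N)) : n.-tuple R :=
  [tuple (tnth j i)%:R / N%:R - M%:R | i < n].

Lemma grid_cover {R : realType} {n : nat} (M N : nat) (x : n.-tuple R) :
  (0 < N)%N -> box (origin R n) M%:R x ->
  exists j, box (grid M N j) N%:R^-1 x.
Proof.
move=> N0 xM.
have xMi i : `|tnth x i| <= M%:R by have := xM i; rewrite tnth_mktuple subr0.
have [g gP] := choice (fun i => grid1_cover _ _ _ N0 (xMi i)).
by exists [tuple g i | i < n] => i; rewrite !tnth_mktuple; exact: gP.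
Qed.

(** Pigeonhole principle: a finite cover cannot have all its members lighter
    than the average, by subadditivity. *)
Lemma exists_ge_average {d} {T : measurableType d} {R : realType}
    (mu : {measure set T -> \bar R}) (I : finType) (A : set T)
    (B : I -> set T) (c : R) :
  measurable A -> (forall i, measurable (B i)) -> A `<=` \bigcup_i B i ->
  0 <= c -> (c%:E < mu A)%E ->
  exists i, ((c / #|I|%:R)%:E <= mu (A `&` B i))%E.
Proof.
move=> mA mB AB c0 cA; apply: contrapT => /forallNP small.
have : (mu A <= \sum_(i \in [set` index_enum I]) mu (A `&` B i))%E.
  apply: content_sub_fsum => //; first by move=> i _; exact: measurableI.
  by move=> x Ax; have [i _ Bx] := AB x Ax; exists i; rewrite //= mem_index_enum.
rewrite -fsbig_seq ?index_enum_uniq//; apply/negP; rewrite -ltNge; apply: le_lt_trans cA.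
apply: (@le_trans _ _ (\sum_(i : I) (c / #|I|%:R)%:E)%E).
  by apply: lee_sum => i _; rewrite leNgt; apply/negP => /ltW; exact: small.
rewrite sumEFin lee_fin sumr_const -[leLHS]mulr_natr.
have [->|I0] := eqVneq #|I| 0%N; first by rewrite mulr0.
by rewrite divfK// pnatr_eq0.
Qed.

(** The cells are the products of the cubes about the points of two grids, of
    mesh 1 / N in position and 1 / q in frequency.  The number of them
    that cover a fixed bounded piece of Omega is a constant times N ^ n, whence
    the dependence on N. *)
Lemma exists_heavy_cell {R : realType} {n : nat} (Omega : set (phase_space R n))
    (q : nat) : measurable Omega -> (0 < lebesgue_R2d R n Omega)%E ->
  (0 < q)%N ->
  exists2 c : R, 0 < c & forall N : nat, (0 < N)%N ->
    exists x0 xi0 : n.-tuple R,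
      ((c / N%:R ^+ n)%:E <=
        lebesgue_R2d R n (Omega `&` (box x0 N%:R^-1 `*` box xi0 q%:R^-1)))%E.
Proof.
move=> mO O0 q0; set mu := lebesgue_R2d R n.
pose K (M : nat) : set (phase_space R n) :=
  box (origin R n) M%:R `*` box (origin R n) M%:R.
have mK M : measurable (K M) by apply: borel_lebesgue2; exact: measurable_box.
have bndT (x : n.-tuple R) : exists M : nat, forall i, `|tnth x i| <= M%:R.
  exists (Num.truncn (\sum_i `|tnth x i|)).+1 => i.
  apply: (@le_trans _ _ (\sum_i `|tnth x i|)).
    by rewrite (bigD1 i)//= lerDl sumr_ge0.
  by rewrite ltW// truncnS_gt.
(* Omega is the union of its bounded pieces, one of which is not negligible. *)
have [M muM] : exists M, (0 < mu (Omega `&` K M))%E.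
  apply: contrapT => /forallNP h.
  have : mu.-negligible Omega.
    apply: (@negligibleS _ _ _ mu (\bigcup_M (Omega `&` K M))).
      move=> [x y] Oxy; have [M1 h1] := bndT x; have [M2 h2] := bndT y.
      exists (maxn M1 M2) => //; split => //; split => i /=;
      rewrite tnth_mktuple subr0; [apply: (le_trans (h1 i))|apply: (le_trans (h2 i))];
      by rewrite ler_nat leq_max leqnn ?orbT.
    apply: negligible_bigcup => M; apply/negligibleP; first exact: measurableI.
    by apply/eqP; rewrite eq_le measure_ge0 andbT leNgt; apply/negP/h.
  by move/(negligibleP mu mO).1 => mu0; move: O0; rewrite -/mu mu0 ltxx.
have [c c0 cmu] : exists2 c : R, 0 < c & (c%:E < mu (Omega `&` K M))%E.
  case: (mu _) muM => [r||//]; last by exists 1; rewrite ?ltry.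
  by rewrite lte_fin => r0; exists (r / 2); rewrite ?lte_fin; lra.
exists (c / (((2 * M + 1) ^ n) * ((2 * M + 1) * q) ^ n)%:R).
  by rewrite divr_gt0// ltr0n muln_gt0 !expn_gt0 muln_gt0 q0 andbT addn1.
move=> N N0.
pose B (j : n.-tuple 'I_((2 * M + 1) * N) * n.-tuple 'I_((2 * M + 1) * q)) :
  set (phase_space R n) := box (grid M N j.1) N%:R^-1 `*` box (grid M q j.2) q%:R^-1.
have [|||j] := @exists_ge_average _ _ _ mu _ (Omega `&` K M) B c _ _ _ (ltW c0) cmu.
- exact: measurableI.
- by move=> j; apply: borel_lebesgue2; exact: measurable_box.
- move=> [x y] [_ [/= Kx Ky]].
  have [j1 h1] := grid_cover _ _ _ N0 Kx; have [j2 h2] := grid_cover _ _ _ q0 Ky.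
  by exists (j1, j2).
rewrite card_prod !card_tuple !card_ord => hj.
exists (grid M N j.1), (grid M q j.2).
apply: (@le_trans _ _ (mu (Omega `&` K M `&` B j))); last first.
  apply: le_measure; rewrite ?inE.
  - apply: measurableI; first exact: measurableI.
    by apply: borel_lebesgue2; exact: measurable_box.
  - by apply: measurableI => //; apply: borel_lebesgue2; exact: measurable_box.
  - by move=> z [[? ?] ?].
apply: le_trans hj; rewrite lee_fin -mulrA -invfM -natrX -natrM.
by rewrite mulnAC -expnMn.
Qed.

(** * The Born--Jordan distribution of a spiked wave packet *)

Lemma Re_le_normc {R : realType} (z : R[i]) :
  complex.Re z <= ComplexField.Normc.normc z.
Proof.
case: z => u v /=; apply: (le_trans (ler_norm u)).
by rewrite -sqrtr_sqr ler_wsqrtr// lerDl sqr_ge0.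
Qed.

(** The phases of the exponential kernel and of the two modulations combine into
    a single one, the amplitudes r and s being real. *)
Lemma Re_phases {R : realType} (a b c r s : R) :
  complex.Re (expm2pi a * (r%:C * expm2pi (- b)) * conjc (s%:C * expm2pi (- c)))
  = r * s * cos (2 * pi * (a - b + c)).
Proof.
rewrite /expm2pi /= !(mulrDr, mulrN, cosD, sinD, cosN, sinN); ring.
Qed.

Lemma dotp_add_scaled {R : realType} {d : nat} (xi x y : d.-tuple R) (s t : R) :
  dotp xi (add_scaled x s y) - dotp xi (add_scaled x t y) = (s - t) * dotp xi y.
Proof.
rewrite /dotp -sumrB mulr_sumr; apply: eq_bigr => i _.
by rewrite !tnth_mktuple; ring.
Qed.

(** The inner product of xi - xi0 with y is at most
    d * 2 / (16 d) = 1 / 8, and 2 pi / 8 <= 1 since pi <= 4. *)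
Lemma cos_phase_ge {R : realType} {d : nat} (xi xi0 y : d.-tuple R) :
  box xi0 (16 * d)%:R^-1 xi -> box (origin R d) 2 y ->
  cos 1 <= cos (2 * pi * (dotp xi y - dotp xi0 y)).
Proof.
move=> hxi hy.
have small : `|dotp xi y - dotp xi0 y| <= 8^-1.
  rewrite /dotp -sumrB.
  have [d0|d0] := posnP d.
    by rewrite big1 ?normr0 ?invr_ge0// => i; have := ltn_ord i; rewrite [X in (_ < X)%N]d0.
  apply: (le_trans (ler_norm_sum _ _ _)).
  apply: (@le_trans _ _ (\sum_(i < d) (8^-1 / d%:R))); last first.
    by rewrite sumr_const card_ord -[leLHS]mulr_natr divfK// pnatr_eq0 -lt0n.
  apply: ler_sum => i _; rewrite -mulrBl normrM.
  have := hy i; rewrite tnth_mktuple subr0 => yi.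
  apply: (le_trans (ler_pM _ _ (hxi i) yi)) => //.
  by rewrite natrM; lra.
have p2 := @pihalf_lt2 R; have p1 := @pi_ge2 R.
have p0 : 0 < pi :> R by lra.
rewrite -[leRHS]cos_norm !normrM (@ger0_norm _ pi) ?(ltW p0)// (@ger0_norm _ 2)//.
have t0 := normr_ge0 (dotp xi y - dotp xi0 y).
set t := `|dotp xi y - dotp xi0 y| in small t0 *.
have tpi : 2 * pi * t <= 1.
  have : pi * t <= 4 * 8^-1 by apply: ler_pM => //; lra.
  lra.
have pt0 : 0 <= 2 * pi * t by rewrite !mulr_ge0 ?(ltW p0).
rewrite leNgt ltr_cos -?leNgt// in_itv/=; apply/andP; split => //; lra.
Qed.

(** A narrow peak on a plateau: their interaction produces the blow-up, with
    L^2 norms of the same order when H = eps ^ (- d / 2). *)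
Definition spike {R : realType} {d : nat} (x0 : d.-tuple R) (eps H : R)
  (x : d.-tuple R) : R := H * \1_(box x0 (2 * eps)) x + \1_(box x0 1) x.

Lemma spike_ge1 {R : realType} {d : nat} (x0 : d.-tuple R) {eps H : R} x :
  0 <= H -> box x0 1 x -> 1 <= spike x0 eps H x.
Proof.
by move=> H0 xB; rewrite /spike [\1_(box x0 1) x]indicE mem_set// lerDr mulr_ge0.
Qed.

Lemma spike_ge0 {R : realType} {d : nat} (x0 : d.-tuple R) {eps H : R} x :
  0 <= H -> 0 <= spike x0 eps H x.
Proof. by move=> H0; rewrite addr_ge0 ?mulr_ge0. Qed.

Lemma spike_bounds {R : realType} {d : nat} (x0 : d.-tuple R) {eps H : R} x :
  0 <= eps <= 2^-1 -> 0 <= H ->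
  0 <= spike x0 eps H x <= (H + 1) * \1_(box x0 1) x.
Proof.
move=> /andP[e0 e1] H0; rewrite /spike !indicE.
have [xe|xe] := boolP (x \in box x0 (2 * eps)).
  rewrite (_ : x \in box x0 1 = true) ?mulr1 ?lexx ?addr_ge0//=.
  apply/mem_set => i; apply: le_trans (set_mem xe i) _; lra.
by case: (x \in box x0 1) => /=; rewrite mulr0 ?mulr1 ?mulr0 add0r ?lexx// ler01 lerDr.
Qed.

(** The phase of expm2pi t is - 2 pi t, so that the amplitude is multiplied by
    exp (2 pi i xi0 . x), a modulation at frequency xi0. *)
Definition wave_packet {R : realType} {d : nat} (x0 xi0 : d.-tuple R)
    (eps H : R) (x : d.-tuple R) : R[i] :=
  (spike x0 eps H x)%:C * expm2pi (- dotp xi0 x).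

(** The two points at which the packet is evaluated differ by y, so the
    modulation only replaces the frequency xi of the kernel by xi - xi0. *)
Lemma Re_wigner_integrand {R : realType} {d : nat} (x0 xi0 : d.-tuple R)
    (eps H tau : R) (z : d.-tuple R * d.-tuple R) (y : d.-tuple R) :
  complex.Re (expm2pi (dotp z.2 y)
    * wave_packet x0 xi0 eps H (add_scaled z.1 tau y)
    * conjc (wave_packet x0 xi0 eps H (add_scaled z.1 (- (1 - tau)) y)))
  = spike x0 eps H (add_scaled z.1 tau y)
    * spike x0 eps H (add_scaled z.1 (- (1 - tau)) y)
    * cos (2 * pi * (dotp z.2 y - dotp xi0 y)).
Proof.
rewrite Re_phases; congr (_ * cos (_ * _)).
have := dotp_add_scaled xi0 z.1 y tau (- (1 - tau)).
have -> : tau - - (1 - tau) = 1 by ring.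
by rewrite mul1r => <-; ring.
Qed.

(** The lower bound is that of the peak at x + tau y against the plateau at
    x - (1 - tau) y for y in the unit cube about the origin, whose
    volume is 1.  The upper bound expresses that the integrand vanishes unless
    both points lie in the plateau, which keeps their difference y bounded by
    2. *)
Lemma Re_tau_wigner {R : realType} {d : nat} (x0 xi0 x xi : d.-tuple R)
    (eps H tau : R) :
  0 <= eps <= 2^-1 -> 0 <= H -> 0 < tau < 1 ->
  box x0 eps x -> box xi0 (16 * d)%:R^-1 xi ->
  cos 1 * H * \1_(`]0, eps[) tau
    <= complex.Re (tau_wigner tau (wave_packet x0 xi0 eps H) (x, xi))
    <= (H + 1) ^+ 2 * 4 ^+ d.
Proof.
move=> e01 H0 /andP[t0 t1] xx0 xixi0; have /andP[e0 e1] := e01.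
rewrite /tau_wigner /cintegral; cbn [complex.Re].
pose A : set (completion_type (lebesgue_tuple R d)) := box (origin R d) 2^-1.
pose B : set (completion_type (lebesgue_tuple R d)) := box (origin R d) 2.
have mA : measurable A by apply: borel_lebesgue; exact: measurable_box.
have mB : measurable B by apply: borel_lebesgue; exact: measurable_box.
have muA : lebesgue_Rd R d A = 1%E.
  by rewrite lebesgue_Rd_box ?invr_ge0// mulfV// expr1n.
have muB : lebesgue_Rd R d B = (4 ^+ d)%:E.
  by rewrite lebesgue_Rd_box// -natrM.
have -> : 4 ^+ d = fine (lebesgue_Rd R d B) by rewrite muB.
rewrite -[X in X <= _]mulr1 -[X in _ * X <= _]/(fine 1%E) -muA.
have c1 := cos1_gt0 R.
apply: Rintegral_between => //.
- by rewrite mulr_ge0// mulr_ge0// ltW.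
- by rewrite exprn_ge0// addr_ge0.
- by rewrite [ltLHS]muA ltry.
- by rewrite [ltLHS]muB ltry.
move=> y _; rewrite Re_wigner_integrand; cbn [fst snd].
set u := add_scaled x tau y; set v := add_scaled x (- (1 - tau)) y.
have /andP[u0 uH] := spike_bounds x0 u e01 H0.
have /andP[v0 vH] := spike_bounds x0 v e01 H0.
(* Outside B at least one of the two points u and v = u - y leaves the plateau. *)
have [yB|yB] := boolP (y \in B); last first.
  have suv0 : spike x0 eps H u * spike x0 eps H v = 0.
    move: uH vH; rewrite !indicE.
    have [uB|_] := boolP (u \in box x0 1); last first.
      rewrite /= mulr0 => uH _.
      by rewrite (le_anti (introT andP (conj uH u0))) mul0r.
    have [vB|_] := boolP (v \in box x0 1); last first.
      rewrite /= mulr0 => _ vH.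
      by rewrite (le_anti (introT andP (conj vH v0))) mulr0.
    move=> _ _; case/negP: yB; apply/mem_set => i.
    have uvy : tnth u i - tnth v i = tnth y i by rewrite !tnth_mktuple; ring.
    rewrite tnth_mktuple subr0 -uvy.
    have := set_mem uB i; have := set_mem vB i; rewrite !ler_norml; lra.
  have yA : y \notin A.
    apply: contra yB => /set_mem yA; apply/mem_set => i.
    apply: le_trans (yA i) _; lra.
  by rewrite suv0 mul0r !indicE (negbTE yA) (negbTE yB) !mulr0 lexx.
have cb := cos_phase_ge _ _ _ xixi0 (set_mem yB).
have c_le1 := cos_le1 (2 * pi * (dotp xi y - dotp xi0 y)).
rewrite [X in _ && (_ <= _ * X)]indicE yB mulr1.
set c := cos (2 * pi * _) in cb c_le1 *.
have c0 : 0 <= c by rewrite (le_trans _ cb)// ltW.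
have {}uH : spike x0 eps H u <= H + 1.
  by apply: (le_trans uH); rewrite ler_piMr ?addr_ge0// indicE lern1 leq_b1.
have {}vH : spike x0 eps H v <= H + 1.
  by apply: (le_trans vH); rewrite ler_piMr ?addr_ge0// indicE lern1 leq_b1.
apply/andP; split; last first.
  rewrite -[leRHS]mulr1 expr2; apply: ler_pM => //; first exact: mulr_ge0.
  exact: ler_pM.
rewrite [\1_A y]indicE; have [yA|_] := boolP (y \in A); last first.
  by rewrite mulr0 !mulr_ge0.
rewrite indicE; have [te|_] := boolP (tau \in _); last first.
  by rewrite mulr0 mul0r !mulr_ge0.
have {te} te : tau < eps by have := set_mem te; rewrite /= in_itv/= => /andP[].
rewrite !mulr1 mulrC; apply: ler_pM => //; first exact: ltW.
have yi i : `|tnth y i| <= 2^-1 by have := set_mem yA i; rewrite tnth_mktuple subr0.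
(* Here |x - x0| <= eps and tau |y| <= eps / 2. *)
have uS : box x0 (2 * eps) u.
  move=> i; rewrite tnth_mktuple addrAC (le_trans (ler_normD _ _))//.
  have : `|tau * tnth y i| <= eps * 2^-1.
    by rewrite normrM; apply: ler_pM; rewrite ?normr_ge0// ger0_norm ltW.
  have := xx0 i; lra.
(* Here |x - x0| <= 1 / 2 and (1 - tau) |y| <= 1 / 2. *)
have vS : box x0 1 v.
  move=> i; rewrite tnth_mktuple addrAC (le_trans (ler_normD _ _))//.
  have : `|- (1 - tau) * tnth y i| <= 1 * 2^-1.
    rewrite normrM; apply: ler_pM; rewrite ?normr_ge0// normrN ger0_norm; lra.
  have := xx0 i; lra.
rewrite -[leLHS]mulr1; apply: ler_pM => //.
  by rewrite /spike indicE mem_set// mulr1 lerDl.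
exact: spike_ge1.
Qed.

(** Only the tau below eps are used for the lower bound; the other ones
    contribute a nonnegative amount since there is no cancellation. *)
Lemma Re_born_jordan {R : realType} {d : nat} (x0 xi0 x xi : d.-tuple R)
    (eps H : R) :
  0 <= eps <= 2^-1 -> 0 <= H ->
  box x0 eps x -> box xi0 (16 * d)%:R^-1 xi ->
  cos 1 * H * eps <= complex.Re (born_jordan (wave_packet x0 xi0 eps H) (x, xi)).
Proof.
move=> e01 H0 xx0 xixi0; have /andP[e0 e1] := e01.
rewrite /born_jordan /cintegral; cbn [complex.Re].
have muA : lebesgue_measure (`]0, eps[ : set R) = eps%:E.
  rewrite lebesgue_measure_itv/= lte_fin; case: ltP => e; first by rewrite oppr0 adde0.
  by congr _%:E; lra.
have muB : lebesgue_measure (`]0, 1[ : set R) = 1%:E.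
  by rewrite lebesgue_measure_itv/= lte_fin ltr01 oppr0 adde0.
rewrite -[X in _ * X <= _]/(fine eps%:E) -muA.
have c1 := cos1_gt0 R.
suff /andP[] : cos 1 * H * fine (lebesgue_measure (`]0, eps[ : set R))
    <= \int[lebesgue_measure]_(tau in `]0, 1[)
         complex.Re (tau_wigner tau (wave_packet x0 xi0 eps H) (x, xi))
    <= (H + 1) ^+ 2 * 4 ^+ d * fine (lebesgue_measure (`]0, 1[ : set R)) by [].
apply: Rintegral_between => //.
- by move=> t /=; rewrite !in_itv/= => /andP[-> te]; rewrite (lt_le_trans te)//; lra.
- by rewrite mulr_ge0// ltW.
- by rewrite mulr_ge0// exprn_ge0// addr_ge0.
- by rewrite [ltLHS]muA ltry.
- by rewrite [ltLHS]muB ltry.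
move=> tau tau01; rewrite [\1_`]0, 1[ tau]indicE (mem_set tau01) mulr1.
apply: Re_tau_wigner => //; by move: tau01; rewrite /= in_itv.
Qed.

(** * The norm of the wave packet and the choice of scale *)

Lemma normc_wave_packet {R : realType} {d : nat} (x0 xi0 x : d.-tuple R)
    (eps H : R) : 0 <= H ->
  ComplexField.Normc.normc (wave_packet x0 xi0 eps H x) = spike x0 eps H x.
Proof.
move=> H0; rewrite /wave_packet ComplexField.Normc.normcM /=.
rewrite expr0n/= addr0 sqrtr_sqr ger0_norm ?spike_ge0//.
by rewrite sqrrN cos2Dsin2 sqrtr1 mulr1.
Qed.

Lemma cmeasurable_wave_packet {R : realType} {d : nat} (x0 xi0 : d.-tuple R)
    (eps H : R) :
  cmeasurable (wave_packet x0 xi0 eps H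
    : completion_type (lebesgue_tuple R d) -> R[i]).
Proof.
have ms : measurable_fun [set: d.-tuple R] (spike x0 eps H).
  have mI r : measurable_fun [set: d.-tuple R] (\1_(box x0 r) : _ -> R).
    exact: (measurable_indic (measurable_box x0 r)).
  by apply: measurable_funD => //; exact: measurable_funM.
have mp : measurable_fun [set: d.-tuple R] (fun x => 2 * pi * (- dotp xi0 x)).
  apply: measurable_funM => //; apply: measurable_funN.
  apply: measurable_sum => i; apply: measurable_funM => //.
  exact: measurable_tnth.
split; apply: measurable_lebesgue.
  rewrite (_ : (fun x => _) = (spike x0 eps H \*
      (cos \o (fun x => 2 * pi * (- dotp xi0 x))))); last first.
    by apply/funext => x /=; rewrite mul0r subr0.
  apply: measurable_funM => //; apply: measurableT_comp mp.
  by apply: continuous_measurable_fun; exact: continuous_cos.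
rewrite (_ : (fun x => _) = (spike x0 eps H \*
    (\- (sin \o (fun x => 2 * pi * (- dotp xi0 x)))))); last first.
  by apply/funext => x /=; rewrite mul0r addr0.
apply: measurable_funM => //; apply: measurable_funN; apply: measurableT_comp mp.
by apply: continuous_measurable_fun; exact: continuous_sin.
Qed.

(** From (a + b)^2 <= 2 a^2 + 2 b^2, the peak and the plateau contribute
    separately. *)
Lemma L2norm_wave_packet {R : realType} {d : nat} (x0 xi0 : d.-tuple R)
    (eps H : R) : 0 <= eps -> 0 <= H ->
  (cLnorm (lebesgue_Rd R d) 2%:E (wave_packet x0 xi0 eps H) ^+ 2
    <= (2 * (H ^+ 2 * (4 * eps) ^+ d + 2 ^+ d))%:E)%E.
Proof.
move=> e0 H0; rewrite /cLnorm unlock.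
set I := (\int[_]_x _)%E.
have I0 : (0 <= I)%E by apply: integral_ge0 => x _; exact: poweR_ge0.
rewrite poweR12_sqrt// sqr_sqrte//.
pose S : set (completion_type (lebesgue_tuple R d)) := box x0 (2 * eps).
pose B : set (completion_type (lebesgue_tuple R d)) := box x0 1.
have mS : measurable S by apply: borel_lebesgue; exact: measurable_box.
have mB : measurable B by apply: borel_lebesgue; exact: measurable_box.
have muS : lebesgue_Rd R d S = ((4 * eps) ^+ d)%:E.
  by rewrite lebesgue_Rd_box ?mulr_ge0// mulrA -natrM.
have muB : lebesgue_Rd R d B = (2 ^+ d)%:E by rewrite lebesgue_Rd_box// mulr1.
have H20 : 0 <= 2 * H ^+ 2 by rewrite mulr_ge0// exprn_ge0.
apply: (@le_trans _ _ (\int[lebesgue_Rd R d]_x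
    (2 * H ^+ 2 * \1_S x + 2 * \1_B x)%:E)%E).
  apply: ge0_le_integral_nomeas => x _; first exact: poweR_ge0.
  rewrite normc_wave_packet// gee0_abs ?lee_fin ?spike_ge0//.
  rewrite powR_mulrn ?spike_ge0// /spike -/S -/B.
  rewrite !indicE -subr_ge0.
  suff -> : forall s b : bool, 2 * H ^+ 2 * s%:R + 2 * b%:R - (H * s%:R + b%:R) ^+ 2
      = (H * s%:R - b%:R) ^+ 2 by exact: sqr_ge0.
  by case=> -[] /=; ring.
rewrite integral_two_indic// muS muB -!EFinM -EFinD lee_fin.
by rewrite mulrDr mulrA.
Qed.

(** The modulus is at least 1 on the whole plateau. *)
Lemma wave_packet_not_ae0 {R : realType} {d : nat} (x0 xi0 : d.-tuple R)
    (eps H : R) : 0 <= H ->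
  ~ {ae lebesgue_Rd R d, forall x, wave_packet x0 xi0 eps H x = 0}.
Proof.
move=> H0 ae0.
pose B : set (completion_type (lebesgue_tuple R d)) := box x0 1.
have mB : measurable B by apply: borel_lebesgue; exact: measurable_box.
have : lebesgue_Rd R d B = 0%E.
  apply: (negligibleP _ mB).1; apply: negligibleS ae0 => x Bx /= w0.
  have := normc_wave_packet x0 xi0 x eps H H0.
  rewrite w0 ComplexField.Normc.normc0 => s0.
  by have := @spike_ge1 _ _ x0 eps H x H0 Bx; rewrite -s0 ler10.
rewrite lebesgue_Rd_box// mulr1 => /eqP.
by rewrite eqe expf_eq0 pnatr_eq0 andbF.
Qed.

(** The quantity to be made large grows like the power d - 2 - 2 d s of k,
    which is positive by the assumption on s; with s = 1 / p that assumption is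
    p > 2 d / (d - 2). *)
Lemma exists_large_scale {R : realType} (d : nat) (s a c X : R) :
  (0 < d)%N -> 0 < a -> 0 < c -> s < 2^-1 - d%:R^-1 ->
  exists2 k : nat, (1 < k)%N &
    X <= a * (k%:R ^+ d / k%:R ^+ 2) * (c / (k%:R ^+ 2) ^+ d) `^ s.
Proof.
move=> d0 a0 c0 hs; have dR : 0 < d%:R :> R by rewrite ltr0n.
pose e : R := d%:R - 2 - 2 * d%:R * s.
have e0 : 0 < e.
  have : 2 * d%:R * s < 2 * d%:R * (2^-1 - d%:R^-1) by rewrite ltr_pM2l ?mulr_gt0.
  have -> : 2 * d%:R * (2^-1 - d%:R^-1) = d%:R - 2 :> R by field; rewrite gt_eqF.
  by rewrite /e; lra.
have acs : 0 < a * c `^ s by rewrite mulr_gt0// powR_gt0.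
(* y is the value of k at which the bound becomes an equality. *)
pose y := (`|X| / (a * c `^ s)) `^ e^-1.
exists (Num.truncn y).+2 => //; set k : R := _%:R.
have yk : y <= k by rewrite ltW// (lt_le_trans (truncnS_gt y))// ler_nat.
have k0 : 0 < k by rewrite ltr0n.
have -> : a * (k ^+ d / k ^+ 2) * (c / (k ^+ 2) ^+ d) `^ s = a * c `^ s * k `^ e.
  have -> : k ^+ d / k ^+ 2 = k `^ (d%:R - 2).
    rewrite powRD; last by rewrite (gt_eqF k0) implybT.
    by rewrite powRN !powR_mulrn ?(ltW k0).
  have -> : (c / (k ^+ 2) ^+ d) `^ s = c `^ s * k `^ (- (2 * d%:R * s)).
    rewrite powRM ?(ltW c0) ?invr_ge0 ?exprn_ge0 ?(ltW k0)//; congr (_ * _).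
    rewrite -exprM -powR_mulrn ?(ltW k0)// -powRN -powRrM; congr (_ `^ _).
    by rewrite natrM; ring.
  rewrite mulrACA -powRD; last by rewrite (gt_eqF k0) implybT.
  by congr (_ * _ `^ _); rewrite /e; ring.
rewrite (le_trans (ler_norm X))// mulrC -ler_pdivrMr//.
apply: (@le_trans _ _ (y `^ e)).
  by rewrite /y -powRrM mulVf ?gt_eqF// powRr1// divr_ge0// ltW.
by apply: ge0_ler_powR; rewrite ?nnegrE ?powR_ge0 ?(ltW e0) ?(ltW k0).
Qed.

Theorem theorem1p6 (R : realType) (d : nat) (hd : (2 < d)%N)
    (Omega : set (phase_space R d)) (mOmega : measurable Omega)
    (Omega_gt0 : (0 < lebesgue_R2d R d Omega)%E)
    (p : \bar R) (hp : ((critical_exponent R d)%:E < p)%E) :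
  ereal_sup
    [set (cLnorm (mrestr (lebesgue_R2d R d) mOmega) p (@born_jordan R d f)
            / (cLnorm (lebesgue_Rd R d) 2%:E f) ^+ 2)%E
    | f in [set f : d.-tuple R -> R[i] |
             L2fun (lebesgue_Rd R d) f /\
             ~ {ae lebesgue_Rd R d, forall x, f x = 0}]]
  = +oo%E.
Proof.
apply: eq_infty => A.
have d0 : (0 < d)%N by exact: ltn_trans hd.
have dR : 0 < 2^-1 - d%:R^-1 :> R.
  by rewrite subr_gt0 ltf_pV2 ?posrE ?ltr0n// ltr_nat.
have p0 : (0 < p)%E by apply: lt_trans hp; rewrite lte_fin invr_gt0.
have hs : fine p^-1 < 2^-1 - d%:R^-1.
  move: p0 hp; case: p => [p|_ _|//]; last by rewrite invey.
  rewrite !lte_fin => p0 hp; rewrite inver gt_eqF//=.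
  by rewrite -[ltRHS]invrK ltf_pV2 ?posrE// invr_gt0.
have q0 : (0 < 16 * d)%N by rewrite muln_gt0.
have [c c0 heavy] := exists_heavy_cell Omega (16 * d) mOmega Omega_gt0 q0.
have C0 : 0 < 4 * 4 ^+ d :> R by rewrite mulr_gt0 ?exprn_gt0.
(* The packet of scale k has squared norm at most 4 * 4 ^ d, so that this k brings the quotient to at least A. *)
have [k k1 large] := exists_large_scale d (fine p^-1) (cos 1) c
  (`|A| * (4 * 4 ^+ d)) d0 (cos1_gt0 R) c0 hs.
have k0 : (0 < k ^ 2)%N by rewrite expn_gt0 ltnW.
have kR : 0 < k%:R :> R by rewrite ltr0n ltnW.
have [x0 [xi0]] := heavy (k ^ 2)%N k0; rewrite natrX => cell.
have e01 : 0 <= ((k%:R : R) ^+ 2)^-1 <= 2^-1.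
  rewrite invr_ge0 exprn_ge0 ?(ltW kR)//=.
  rewrite lef_pV2 ?posrE ?exprn_gt0// -natrX ler_nat.
  by rewrite (leq_trans k1)// -[leqLHS]expn1 leq_exp2l.
have H0 : 0 <= k%:R ^+ d :> R by rewrite exprn_ge0.
pose f := wave_packet x0 xi0 (k%:R ^+ 2)^-1 (k%:R ^+ d).
have y2 : (cLnorm (lebesgue_Rd R d) 2%:E f ^+ 2 <= (4 * 4 ^+ d)%:E)%E.
  have /andP[e0 _] := e01.
  apply: (le_trans (L2norm_wave_packet x0 xi0 _ _ e0 H0)); rewrite lee_fin.
  have -> : (k%:R ^+ d) ^+ 2 * (4 * (k%:R ^+ 2)^-1) ^+ d = 4 ^+ d :> R.
    rewrite exprMn exprVn -!exprM mulnC mulrCA mulfV ?mulr1//.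
    by rewrite expf_neq0// gt_eqF.
  have : 2 ^+ d <= 4 ^+ d :> R by apply: lerXn2r; rewrite ?nnegrE// ler_nat.
  lra.
have y0 : (0 <= cLnorm (lebesgue_Rd R d) 2%:E f)%E by exact: Lnorm_ge0.
apply: le_ereal_sup_tmp.
eexists; first (exists f; last reflexivity).
  split; last exact: wave_packet_not_ae0.
  split; first exact: cmeasurable_wave_packet.
  rewrite ltNge leye_eq; apply/negP => /eqP yoo.
  by move: y2; rewrite yoo expe2 mulyy.
have W : ((cos 1 * (k%:R ^+ d / k%:R ^+ 2) * (c / (k%:R ^+ 2) ^+ d) `^ fine p^-1)%:E
    <= cLnorm (mrestr (lebesgue_R2d R d) mOmega) p (@born_jordan R d f))%E.
  rewrite /cLnorm; apply: (Lnorm_ge (mrestr (lebesgue_R2d R d) mOmega)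
    (box x0 (k%:R ^+ 2)^-1 `*` box xi0 (16 * d)%:R^-1)) => //.
  - by apply: borel_lebesgue2; exact: measurable_box.
  - by rewrite mulr_ge0 ?divr_ge0 ?exprn_ge0// ltW// cos1_gt0.
  - by rewrite divr_gt0// !exprn_gt0.
  - by move: cell; rewrite setIC.
  move=> [x xi] [hx hxi].
  have := Re_born_jordan x0 xi0 x xi _ _ e01 H0 hx hxi.
  rewrite mulrA => hu; apply: le_trans (lee_abs _).
  by rewrite lee_fin (le_trans hu)// Re_le_normc.
apply: (@le_trans _ _ ((`|A| * (4 * 4 ^+ d))%:E * ((4 * 4 ^+ d)%:E)^-1)%E).
  by rewrite inver gt_eqF// -EFinM lee_fin mulfK ?gt_eqF// ler_norm.
apply: lee_pmul.
- by rewrite lee_fin mulr_ge0// ltW.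
- by rewrite inve_ge0 lee_fin ltW.
- by apply: le_trans W; rewrite lee_fin.
- by rewrite lee_pV2 ?inE ?lee_fin ?(ltW C0)// expe2 mule_ge0.
Qed.
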